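(* Let $(\mathscr{L},\vdash)$ be a logical structure. Then the following statements are equivalent. (1) $(\mathscr{L},\vdash)$ is of Lindenbaum-IV-type. (2) For all $\Gamma\cup\{\alpha\}\subseteq\mathscr{L}$, if $\Gamma\nvdash\alpha$ then there exists a maximal $\alpha$-saturated set $\Sigma\supseteq\Gamma$ (i.e. $\Sigma$ is $\alpha$-saturated and no proper superset of $\Sigma$ is $\alpha$-saturated). (3) For all $\Gamma\cup\{\alpha\}\subseteq\mathscr{L}$, the set $\mathsf{Lim}_\mathscr{L}(\Gamma,\alpha):=\{\Sigma\subseteq\mathscr{L}:\Gamma\subseteq\Sigma\text{ and }\Sigma\nvdash\alpha\}$ has a maximal element with respect to inclusion whenever it is nonempty.
   Context: A logical structure is a pair $(\mathscr{L},\vdash)$ with $\mathscr{L}$ a nonempty set and $\vdash\subseteq\mathcal{P}(\mathscr{L})\times\mathscr{L}$ nonempty; write $\Gamma\vdash\alpha$ for $(\Gamma,\alpha)\in\vdash$. For $\Gamma\cup\{\alpha\}\subseteq\mathscr{L}$: $\Gamma$ is $\alpha$-saturated if $\Gamma\nvdash\alpha$ but $\Gamma\cup\{\beta\}\vdash\alpha$ for every $\beta\in\mathscr{L}\setminus\Gamma$; $\Gamma$ is relatively maximal in $\alpha$ if $\Gamma\nvdash\alpha$ but $\Sigma\vdash\alpha$ for every $\Sigma\supsetneq\Gamma$. $(\mathscr{L},\vdash)$ is of Lindenbaum-IV-type if for all $\Gamma\cup\{\alpha\}\subseteq\mathscr{L}$ with $\Gamma\nvdash\alpha$ there exists $\Sigma\supseteq\Gamma$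 which is relatively maximal in $\alpha$. *)

(* Defs.v *)
From mathcomp Require Import all_boot.
From mathcomp Require Import boolp classical_sets.

Set Implicit Arguments.
Unset Strict Implicit.
Unset Printing Implicit Defensive.

Local Open Scope classical_set_scope.

(* The underlying set is a bare type: no decidable equality or choice structure
   is assumed on it. *)
Record logicalStructure := LogicalStructure {
  carrier :> Type;
  entails : set carrier -> carrier -> Prop;
  carrier_nonempty : [set: carrier] !=set0;
  entails_nonempty : exists (Gamma : set carrier) (alpha : carrier),
    entails Gamma alpha
}.

Definition saturated (L : logicalStructure) (alpha : L) (Gamma : set L) : Prop :=
  ~ entails Gamma alpha /\
  forall beta : L, ~ Gamma beta -> entails (Gamma `|` [set beta]) alpha.

(* In classical_sets, A `<` B is strict inclusion: A `<=` B /\ ~ (B `<=` A). *)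
Definition relatively_maximal (L : logicalStructure) (alpha : L)
    (Gamma : set L) : Prop :=
  ~ entails Gamma alpha /\
  forall Sigma : set L, Gamma `<` Sigma -> entails Sigma alpha.

Definition LindenbaumIV (L : logicalStructure) : Prop :=
  forall (Gamma : set L) (alpha : L), ~ entails Gamma alpha ->
  exists Sigma : set L, Gamma `<=` Sigma /\ relatively_maximal alpha Sigma.

Definition maximal_in (T : Type) (F : set (set T)) (A : set T) : Prop :=
  F A /\ forall B : set T, A `<` B -> ~ F B.

Definition Lim (L : logicalStructure) (Gamma : set L) (alpha : L) :
    set (set L) :=
  [set Sigma | Gamma `<=` Sigma /\ ~ entails Sigma alpha].

(* Main.v *)
(** A set is relatively maximal in [alpha] exactly when it is maximal in
    [Lim Gamma alpha] for some (equivalently, every) [Gamma] below it, and it is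
    then maximal [alpha]-saturated. Conversely, if a maximal [alpha]-saturated
    set had a proper superset not entailing [alpha], statement (2) applied to
    that superset would yield a strictly larger [alpha]-saturated set. *)
Require Import Defs.
From mathcomp Require Import all_boot.
From mathcomp Require Import boolp classical_sets.

Local Open Scope classical_set_scope.

(** Once [Sigma] contains [Gamma], so do all its supersets; membership in [Lim Gamma alpha] then
    only asks that they fail to entail [alpha]. *)
Lemma maximal_in_LimP (L : logicalStructure) (Gamma Sigma : set L) (alpha : L) :
  maximal_in (Lim Gamma alpha) Sigma <->
  Gamma `<=` Sigma /\ relatively_maximal alpha Sigma.
Proof.
split.
- move=> [[GS nS] maxS]; split=> //; split=> // Delta ltSD.
  apply: contrapT => nD; apply: (maxS _ ltSD); split=> //.
  exact: subset_trans GS (properW ltSD).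
- move=> [GS [nS maxS]]; split=> // Delta ltSD [_ nD].
  exact: nD (maxS _ ltSD).
Qed.

(** Adjoining a single [beta] outside [Sigma] already yields a proper superset. *)
Lemma relatively_maximal_saturated (L : logicalStructure) (alpha : L)
    (Sigma : set L) :
  relatively_maximal alpha Sigma -> saturated alpha Sigma.
Proof.
move=> [nS maxS]; split=> // beta nSb; apply: maxS; split.
  exact: subsetUl.
by move=> /(_ beta) sub; apply/nSb/sub; right.
Qed.

Lemma relatively_maximal_maximal_saturated (L : logicalStructure) (alpha : L)
    (Sigma : set L) :
  relatively_maximal alpha Sigma ->
  maximal_in [set Delta | saturated alpha Delta] Sigma.
Proof.
move=> maxS; split; first exact: relatively_maximal_saturated.
by move=> Delta ltSD [nD _]; apply/nD/(maxS.2 _ ltSD).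
Qed.

Theorem mainTheorem2 (L : logicalStructure) :
  let statement1 := LindenbaumIV L in
  let statement2 :=
    forall (Gamma : set L) (alpha : L), ~ entails Gamma alpha ->
    exists Sigma : set L,
      Gamma `<=` Sigma /\ maximal_in [set Delta | saturated alpha Delta] Sigma in
  let statement3 :=
    forall (Gamma : set L) (alpha : L), Lim Gamma alpha !=set0 ->
    exists Sigma : set L, maximal_in (Lim Gamma alpha) Sigma in
  (statement1 <-> statement2) /\ (statement2 <-> statement3) /\
  (statement1 <-> statement3).
Proof.
move=> S1 S2 S3.
have S12 : S1 <-> S2.
  split=> [H Gamma alpha /H[Sigma [GS maxS]] | H Gamma alpha nG].
    by exists Sigma; split=> //; exact: relatively_maximal_maximal_saturated.
  have [Sigma [GS [[nS satS] maxS]]] := H _ _ nG.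
  exists Sigma; split=> //; split=> // Delta ltSD.
  apply: contrapT => /H[Theta [DT [satT _]]].
  (* [Theta] is strictly above [Sigma], since it contains [Delta], which is not inside [Sigma]. *)
  apply: (maxS Theta _ satT); split; first exact: subset_trans (properW ltSD) DT.
  by move=> TS; apply: ltSD.2; exact: subset_trans DT TS.
have S13 : S1 <-> S3.
  split=> [H Gamma alpha [Delta [GD nD]] | H Gamma alpha nG].
    (* The set to extend is [Delta], not [Gamma]: entailment need not be monotone, so [Gamma] may
       entail [alpha] even though [Delta] does not. *)
    have [Sigma [DS maxS]] := H _ _ nD.
    exists Sigma; apply/maximal_in_LimP; split=> //.
    exact: subset_trans GD DS.
  have [|Sigma /maximal_in_LimP maxS] := H Gamma alpha; first by exists Gamma; split.
  by exists Sigma.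
split; first exact: S12.
split; last exact: S13.
exact: iff_trans (iff_sym S12) S13.
Qed.
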